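(* Let $X=\mathbb{R}^{m\times n}$, let $A:X\to Y_0=\mathbb{R}^{m_0\times n_0}$ and $K_l:X\to Y_l=\mathbb{R}^{m_l\times n_l\times c_l}$, $l=1,\dots,k$, be (bounded) linear operators, let $\boldsymbol{x}_0\in Y_0$, and let $\mu_l>0$, $\tau_l>0$ for $l=1,\dots,k$. Then the general truncated quadratic regularization functional $$F(\boldsymbol{x})=\frac{\|A\boldsymbol{x}-\boldsymbol{x}_0\|_2^2}{2}+\sum_{l=1}^k\sum_{i=1}^{m_l}\sum_{j=1}^{n_l}\frac{\mu_l}{2}\min\bigl(|(K_l\boldsymbol{x})_{i,j}|^2,\tau_l\bigr),\qquad \boldsymbol{x}\in X,$$ is a KL function with exponent $\tfrac12$.
   Context: Here $(K_l\boldsymbol{x})_{i,j}\in\mathbb{R}^{c_l}$ and $|\cdot|$ is the Euclidean norm; $X$ is identified with $\mathbb{R}^{mn}$ by vectorization. Limiting subdifferential: for a proper lower semicontinuous $h:\mathbb{R}^N\to\mathbb{R}\cup\{+\infty\}$ and $x\in\operatorname{dom}h=\{h<+\infty\}$, $\partial h(x)$ is the set of $\xi\in\mathbb{R}^N$ for which there are $x_k\to x$ with $h(x_k)\to h(x)$ and $\xi_k\to\xi$ such that $\liminf_{y\to x_k,\,y\ne x_k}\frac{h(y)-h(x_k)-\langle\xi_k,y-x_k\rangle}{|y-x_k|}\ge 0$ for every $k$. $\operatorname{dom}\partial h=\{x:\partial h(x)\neq\emptyset\}$. KL exponent: a proper closed function $h$ satisfies the KL property at $\bar x\in\operatorname{dom}\partial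 h$ with exponent $\theta\in[0,1)$ if there exist $c>0$, $a\in(0,+\infty]$ and a neighborhood $\mathcal{O}$ of $\bar x$ such that, with $\psi(s)=cs^{1-\theta}$, for all $x\in\mathcal{O}$ with $h(\bar x)<h(x)<h(\bar x)+a$ one has $\psi'(h(x)-h(\bar x))\operatorname{dist}(0,\partial h(x))\ge 1$; equivalently $\operatorname{dist}(0,\partial h(x))\ge\bar c\,(h(x)-h(\bar x))^{\theta}$ for some $\bar c>0$ (with $\operatorname{dist}(0,\emptyset)=+\infty$). $h$ is a KL function with exponent $\theta$ if this holds at every point of $\operatorname{dom}\partial h$. *)

(* Defs.v *)
From HB Require Import structures.
From mathcomp Require Import all_boot all_order all_algebra.
From mathcomp Require Import all_classical all_reals all_analysis.

Set Implicit Arguments.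
Unset Strict Implicit.
Unset Printing Implicit Defensive.

Import Order.TTheory GRing.Theory Num.Theory.
Import numFieldNormedType.Exports.

Local Open Scope classical_set_scope.
Local Open Scope ring_scope.

Definition inner (R : realType) (N : nat) (u v : 'rV[R]_N) : R :=
  \sum_(i < N) u ord0 i * v ord0 i.

(* The library norm of 'rV[R]_N is the sup norm, hence a separate Euclidean
   norm; the two induce the same topology, so neighbourhoods and limits below
   are the library ones. *)
Definition enorm (R : realType) (N : nat) (u : 'rV[R]_N) : R :=
  Num.sqrt (inner u u).

Definition edom (R : realType) (N : nat) (h : 'rV[R]_N -> \bar R) :
    set 'rV[R]_N :=
  [set x | (h x < +oo)%E].

Definition proper_fun (R : realType) (N : nat) (h : 'rV[R]_N -> \bar R) : Prop :=
  (forall x, (-oo < h x)%E) /\ edom h !=set0.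

Definition regular_subgradient (R : realType) (N : nat)
    (h : 'rV[R]_N -> \bar R) (x xi : 'rV[R]_N) : Prop :=
  edom h x /\
  (0 <= limf_einf
     (fun y => (h y - h x - (inner xi (y - x))%:E) * ((enorm (y - x))^-1)%:E)
     x^')%E.

Definition limiting_subdiff (R : realType) (N : nat)
    (h : 'rV[R]_N -> \bar R) (x : 'rV[R]_N) : set 'rV[R]_N :=
  [set xi | edom h x /\
     exists (xs xis : nat -> 'rV[R]_N),
       [/\ xs k @[k --> \oo] --> x,
           h (xs k) @[k --> \oo] --> h x,
           xis k @[k --> \oo] --> xi
         & forall k, regular_subgradient h (xs k) (xis k)]].

Definition dom_subdiff (R : realType) (N : nat) (h : 'rV[R]_N -> \bar R) :
    set 'rV[R]_N :=
  [set x | limiting_subdiff h x !=set0].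

(* The value is +oo when S is empty. *)
Definition edist0 (R : realType) (N : nat) (S : set 'rV[R]_N) : \bar R :=
  ereal_inf [set (enorm xi)%:E | xi in S].

Definition desingularizing (R : realType) (c theta : R) : R -> R :=
  fun s => c * s `^ (1 - theta).

(* [fine] loses nothing here: it is only used where h xbar < h x < +oo, with
   h xbar finite since xbar is in dom_subdiff h. *)
Definition KL_at (R : realType) (N : nat) (h : 'rV[R]_N -> \bar R)
    (theta : R) (xbar : 'rV[R]_N) : Prop :=
  exists (c : R) (a : \bar R),
    [/\ 0 < c, (0 < a)%E &
        \forall x \near xbar,
          (h xbar < h x < h xbar + a)%E ->
          (1 <= (derive1 (desingularizing c theta) (fine (h x - h xbar)))%:E
                * edist0 (limiting_subdiff h x))%E].

Definition KL_function (R : realType) (N : nat) (h : 'rV[R]_N -> \bar R)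
    (theta : R) : Prop :=
  [/\ proper_fun h, lower_semicontinuous h, 0 <= theta < 1
    & forall xbar, dom_subdiff h xbar -> KL_at h theta xbar].

(* An element of R^(ml x nl x cl) is a finite family of vectors of R^cl indexed
   by the pairs (i, j). *)
Definition trunc_quad (R : realType) (m n m0 n0 k : nat) (ml nl cl : 'I_k -> nat)
    (A : {linear 'M[R]_(m, n) -> 'M[R]_(m0, n0)}) (x0 : 'M[R]_(m0, n0))
    (K : forall l : 'I_k,
       {linear 'M[R]_(m, n) -> {ffun 'I_(ml l) * 'I_(nl l) -> 'rV[R]_(cl l)}})
    (mu tau : 'I_k -> R) (x : 'M[R]_(m, n)) : R :=
  enorm (mxvec (A x - x0)) ^+ 2 / 2 +
  \sum_(l < k) \sum_(i < ml l) \sum_(j < nl l)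
     mu l / 2 * Num.min (enorm (K l x (i, j)) ^+ 2) (tau l).

(* Main.v *)
(* F is a pointwise minimum of finitely many least-squares functions
   Q(x) = |x M - b|^2 / 2 + c, one for each choice of a branch in every
   truncation. A regular subgradient of F at y is one of each piece active at y,
   so every limiting subgradient of F at x is the gradient of a piece active
   at x. For x near xbar such a piece Q is also active at xbar, hence
   F x - F xbar = Q x - Q xbar, and a least-squares function satisfies globally
   Q x - Q y <= C |grad Q x|^2. *)
Require Import Defs.
From HB Require Import structures.
From mathcomp Require Import all_boot all_order all_algebra.
From mathcomp Require Import all_classical all_reals all_analysis.
From mathcomp Require Import ring lra.

Import Order.TTheory GRing.Theory Num.Theory.
Import numFieldNormedType.Exports.

Set Implicit Arguments.
Unset Strict Implicit.
Unset Printing Implicit Defensive.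

Local Open Scope classical_set_scope.
Local Open Scope ring_scope.

(** * Euclidean inner product: Cauchy-Schwarz and boundedness of matrices *)

Section Inner.
Context {R : realType}.
Implicit Types N p : nat.

Lemma innerE N (u v : 'rV[R]_N) : inner u v = (u *m v^T) 0 0.
Proof. by rewrite mxE; apply: eq_bigr => i _; rewrite mxE. Qed.

Lemma innerC N (u v : 'rV[R]_N) : inner u v = inner v u.
Proof. by apply: eq_bigr => i _; rewrite mulrC. Qed.

Lemma innerDl N (u v w : 'rV[R]_N) : inner (u + v) w = inner u w + inner v w.
Proof. by rewrite !innerE mulmxDl mxE. Qed.

Lemma innerZl N (a : R) (u v : 'rV[R]_N) : inner (a *: u) v = a * inner u v.
Proof. by rewrite !innerE -scalemxAl mxE. Qed.

Lemma innerDr N (u v w : 'rV[R]_N) : inner u (v + w) = inner u v + inner u w.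
Proof. by rewrite innerC innerDl !(innerC _ u). Qed.

Lemma innerZr N (a : R) (u v : 'rV[R]_N) : inner u (a *: v) = a * inner u v.
Proof. by rewrite innerC innerZl innerC. Qed.

Lemma innerNl N (u v : 'rV[R]_N) : inner (- u) v = - inner u v.
Proof. by rewrite -scaleN1r innerZl mulN1r. Qed.

Lemma innerNr N (u v : 'rV[R]_N) : inner u (- v) = - inner u v.
Proof. by rewrite innerC innerNl innerC. Qed.

Lemma inner_mulmxr N p (u : 'rV[R]_p) (v : 'rV[R]_N) (M : 'M[R]_(N, p)) :
  inner u (v *m M) = inner (u *m M^T) v.
Proof. by rewrite !innerE trmx_mul mulmxA. Qed.

Lemma inner_row_mx N p (u v : 'rV[R]_N) (u' v' : 'rV[R]_p) :
  inner (row_mx u u') (row_mx v v') = inner u v + inner u' v'.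
Proof. by rewrite !innerE tr_row_mx mul_row_col mxE. Qed.

Lemma inner_ge0 N (u : 'rV[R]_N) : 0 <= inner u u.
Proof. by apply: sumr_ge0 => i _; rewrite -expr2 sqr_ge0. Qed.

Lemma inner_eq0 N (u : 'rV[R]_N) : (inner u u == 0) = (u == 0).
Proof.
apply/idP/eqP => [|->]; last by rewrite innerE mul0mx mxE.
rewrite psumr_eq0 => [/allP u0|i _]; last by rewrite -expr2 sqr_ge0.
apply/rowP => i; have := u0 i (mem_index_enum i).
by rewrite -expr2 sqrf_eq0 ord1 mxE => /eqP.
Qed.

Lemma inner_gt0 N (u : 'rV[R]_N) : (0 < inner u u) = (u != 0).
Proof. by rewrite lt_def inner_ge0 andbT inner_eq0. Qed.

Lemma enorm_sqr N (u : 'rV[R]_N) : enorm u ^+ 2 = inner u u.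
Proof. by rewrite sqr_sqrtr// inner_ge0. Qed.

Lemma enormZ N (a : R) (u : 'rV[R]_N) : 0 <= a -> enorm (a *: u) = a * enorm u.
Proof.
move=> a0; rewrite /enorm innerZl innerZr mulrA -expr2 sqrtrM ?sqr_ge0//.
by rewrite sqrtr_sqr ger0_norm.
Qed.

Lemma inner_CauchySchwarz N (u v : 'rV[R]_N) :
  inner u v ^+ 2 <= inner u u * inner v v.
Proof.
have [->|u0] := eqVneq u 0.
  by rewrite !innerE !mul0mx !mxE mul0r expr2 mul0r.
(* This vector is |u|^2 times the component of [v] orthogonal to [u]; its squared norm is |u|^2
   (|u|^2 |v|^2 - <u,v>^2). *)
have := inner_ge0 (inner u u *: v - inner u v *: u).
rewrite !(innerDl, innerDr, innerNl, innerNr, innerZl, innerZr) (innerC v u).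
set a := inner u u; set b := inner u v; set c := inner v v => H.
have a0 : 0 < a by rewrite inner_gt0.
rewrite -subr_ge0 -(pmulr_rge0 _ a0).
by congr (0 <= _): H; ring.
Qed.

Lemma inner_mulmx_bound N p (P : 'M[R]_(N, p)) :
  exists2 C, 0 < C & forall u, inner (u *m P) (u *m P) <= C * inner u u.
Proof.
(* The squared Frobenius norm of [P], by Cauchy-Schwarz on each column; adding 1 makes the constant
   positive even for [P] = 0. *)
exists (1 + \sum_j inner (col j P)^T (col j P)^T) => [|u].
  by rewrite ltr_pwDl// sumr_ge0// => j _; exact: inner_ge0.
rewrite mulrDl mul1r ler_wpDl ?inner_ge0// mulr_suml; apply: ler_sum => j _.
have -> : (u *m P) 0 j = inner u (col j P)^T.
  by rewrite mxE; apply: eq_bigr => i _; rewrite !mxE.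
by rewrite -expr2 mulrC inner_CauchySchwarz.
Qed.

End Inner.

(** * Least-squares functions and their finite pointwise minima *)

Section LeastSquares.
Context {R : realType}.
Implicit Types N p : nat.

(** The residual dimension is a field, so that functions with residuals of different sizes share one
    type and can be added by stacking. *)
Record lsq N := Lsq {
  lsq_dim : nat;
  lsq_mx : 'M[R]_(N, lsq_dim);
  lsq_target : 'rV[R]_lsq_dim;
  lsq_shift : R }.

Definition lsq_residual N (Q : lsq N) (x : 'rV[R]_N) :=
  x *m lsq_mx Q - lsq_target Q.

Definition lsq_val N (Q : lsq N) (x : 'rV[R]_N) : R :=
  inner (lsq_residual Q x) (lsq_residual Q x) / 2 + lsq_shift Q.

Definition lsq_grad N (Q : lsq N) (x : 'rV[R]_N) : 'rV_N :=
  lsq_residual Q x *m (lsq_mx Q)^T.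

Lemma lsq_valD N (Q : lsq N) x d :
  lsq_val Q (x + d) = lsq_val Q x + inner (lsq_grad Q x) d +
                      inner (d *m lsq_mx Q) (d *m lsq_mx Q) / 2.
Proof.
rewrite /lsq_val /lsq_grad -inner_mulmxr /lsq_residual mulmxDl addrAC.
move: (x *m _ - _) (d *m _) => r e.
by rewrite innerDl !innerDr (innerC e r); field.
Qed.

(* Put d = (y - x) M. Since M M^+ M = M, the linear term <grad Q x, y - x> of
   Q y equals <grad Q x (M^+)^T, d>, and completing the square against the
   quadratic term |d|^2 / 2 bounds Q x - Q y by |grad Q x (M^+)^T|^2 / 2. *)
Lemma lsq_grad_dominated N (Q : lsq N) :
  exists C, 0 < C /\ forall x y,
    lsq_val Q x - lsq_val Q y <= C * inner (lsq_grad Q x) (lsq_grad Q x).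
Proof.
set M := lsq_mx Q; have [C C0 HC] := inner_mulmx_bound (pinvmx M)^T.
exists C; split => // x y; set g := lsq_grad Q x; pose d := (y - x) *m M.
have gd : inner g (y - x) = inner (g *m (pinvmx M)^T) d.
  rewrite -inner_mulmxr [g]/(lsq_grad _ _) /lsq_grad -!inner_mulmxr.
  by rewrite mulmxKpV ?submxMl.
have -> : y = x + (y - x) by rewrite addrC subrK.
rewrite lsq_valD -/g -/M gd -/d.
have := inner_ge0 (g *m (pinvmx M)^T + d).
rewrite innerDl !innerDr (innerC d (g *m _)).
have := HC g; have := inner_ge0 (g *m (pinvmx M)^T); lra.
Qed.

Lemma continuous_mulmx_coord N p (M : 'M[R]_(N, p)) i :
  continuous (fun x : 'rV[R]_N => (x *m M) (0 : 'I_1) i).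
Proof.
have H j : continuous (fun x : 'rV[R]_N => x ord0 j * M j i).
  move=> x; apply: continuousM; first exact: coord_continuous.
  exact: cst_continuous.
have -> : (fun x : 'rV[R]_N => (x *m M) 0 i) =
          (fun x => \sum_(j <- index_enum _) x 0 j * M j i).
  by apply/funext => x; rewrite mxE.
by apply: (continuous_big (@add_continuous R)) => j _; exact: H.
Qed.

Lemma continuous_lsq_val N (Q : lsq N) : continuous (lsq_val Q).
Proof.
have H i : continuous (fun x => lsq_residual Q x (0 : 'I_1) i).
  have -> : (fun x => lsq_residual Q x 0 i) =
            (fun x : 'rV[R]_N => (x *m lsq_mx Q) 0 i - lsq_target Q 0 i).
    by apply/funext => x; rewrite !mxE.
  move=> x; apply: continuousB; last exact: cst_continuous.
  exact: continuous_mulmx_coord.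
have S : continuous (fun x => \sum_(i <- index_enum _)
    lsq_residual Q x 0 i * lsq_residual Q x 0 i).
  apply: (continuous_big (@add_continuous R)) => i _ y.
  by apply: continuousM; exact: H.
by move=> x; exact: (cvgD (cvgM (S x) (cvg_cst _)) (cvg_cst _)).
Qed.

Lemma continuous_lsq_grad_coord N (Q : lsq N) i :
  continuous (fun x => lsq_grad Q x (0 : 'I_1) i).
Proof.
have -> : (fun x => lsq_grad Q x 0 i) = (fun x : 'rV[R]_N =>
    (x *m (lsq_mx Q *m (lsq_mx Q)^T)) 0 i - (lsq_target Q *m (lsq_mx Q)^T) 0 i).
  by apply/funext => x; rewrite /lsq_grad mulmxBl mulmxA !mxE.
move=> x; apply: continuousB; last exact: cst_continuous.
exact: continuous_mulmx_coord.
Qed.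

Lemma lsq_cst N (c : R) : exists Q : lsq N, lsq_val Q = fun=> c.
Proof.
exists (@Lsq N 0 0 0 c); apply/funext => x.
by rewrite /lsq_val /inner big_ord0 mul0r add0r.
Qed.

Definition lsq_add N (Q1 Q2 : lsq N) : lsq N :=
  Lsq (row_mx (lsq_mx Q1) (lsq_mx Q2))
      (row_mx (lsq_target Q1) (lsq_target Q2)) (lsq_shift Q1 + lsq_shift Q2).

Lemma lsq_val_add N (Q1 Q2 : lsq N) x :
  lsq_val (lsq_add Q1 Q2) x = lsq_val Q1 x + lsq_val Q2 x.
Proof.
rewrite /lsq_val /lsq_residual /= mul_mx_row opp_row_mx add_row_mx.
by rewrite inner_row_mx; ring.
Qed.

Lemma lsq_linear N p (f : {linear 'rV[R]_N -> 'rV[R]_p}) (b : 'rV_p) (w : R) :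
  0 <= w ->
  exists Q : lsq N, lsq_val Q = fun x => w * inner (f x - b) (f x - b).
Proof.
move=> w0; have w20 : 0 <= w * 2 by rewrite mulr_ge0.
(* The weight is absorbed into the residual; the factor 2 cancels the 1/2 in [lsq_val]. *)
exists (Lsq (Num.sqrt (w * 2) *: lin1_mx f) (Num.sqrt (w * 2) *: b) 0).
apply/funext => x; rewrite /lsq_val /lsq_residual /= -scalemxAr mul_rV_lin1.
by rewrite -scalerBr innerZl innerZr mulrA -expr2 sqr_sqrtr//; field.
Qed.

(** Domination and attainment are kept separate: the first bounds difference quotients of [F], the
    second supplies an active piece at each point. *)
Definition is_min_lsq N (I : Type) (Q : I -> lsq N) (F : 'rV[R]_N -> R) : Prop :=
  (forall i x, F x <= lsq_val (Q i) x) /\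
  forall x, exists i, F x = lsq_val (Q i) x.

Definition min_of_lsq N (F : 'rV[R]_N -> R) : Prop :=
  exists (I : finType) (Q : I -> lsq N), is_min_lsq Q F.

Lemma min_of_lsq1 N (Q : lsq N) : min_of_lsq (lsq_val Q).
Proof. by exists unit, (fun=> Q); split => // x; exists tt. Qed.

Lemma min_of_lsq_cst N (c : R) : min_of_lsq (fun _ : 'rV_N => c).
Proof. by have [Q <-] := lsq_cst N c; exact: min_of_lsq1. Qed.

Lemma min_of_lsq_linear N p (f : {linear 'rV[R]_N -> 'rV[R]_p}) (b : 'rV_p)
    (w : R) : 0 <= w -> min_of_lsq (fun x => w * inner (f x - b) (f x - b)).
Proof. by move=> /(lsq_linear f b)[Q <-]; exact: min_of_lsq1. Qed.

(** The two branches are chosen independently, so the sum of the minima is the minimum of the sums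
    over pairs of pieces. *)
Lemma min_of_lsq_add N (F1 F2 : 'rV[R]_N -> R) :
  min_of_lsq F1 -> min_of_lsq F2 -> min_of_lsq (fun x => F1 x + F2 x).
Proof.
move=> [I [Q [FQ exQ]]] [J [P [FP exP]]].
exists (I * J)%type, (fun ij => lsq_add (Q ij.1) (P ij.2)); split.
- by move=> [i j] x; rewrite lsq_val_add lerD.
- move=> x; have [i Qi] := exQ x; have [j Pj] := exP x.
  by exists (i, j); rewrite lsq_val_add Qi Pj.
Qed.

Lemma min_of_lsq_min N (F1 F2 : 'rV[R]_N -> R) :
  min_of_lsq F1 -> min_of_lsq F2 ->
  min_of_lsq (fun x => Num.min (F1 x) (F2 x)).
Proof.
move=> [I [Q [FQ exQ]]] [J [P [FP exP]]].
exists (I + J)%type, (fun ij => match ij with inl i => Q i | inr j => P j end).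
split.
- by move=> [i|j] x; rewrite ge_min ?FQ ?FP ?orbT.
- move=> x; have [i Qi] := exQ x; have [j Pj] := exP x.
  by case: leP => _; [exists (inl i)|exists (inr j)].
Qed.

Lemma min_of_lsq_sum N (I : Type) (s : seq I) (F : I -> 'rV[R]_N -> R) :
  (forall i, min_of_lsq (F i)) -> min_of_lsq (fun x => \sum_(i <- s) F i x).
Proof.
move=> FP; elim: s => [|i s IHs].
  under eq_fun do rewrite big_nil.
  exact: min_of_lsq_cst.
under eq_fun do rewrite big_cons.
exact: min_of_lsq_add.
Qed.

End LeastSquares.

(** * Subgradients of a minimum of least-squares functions and the KL inequality *)

Section Subdifferential.
Context {R : realType}.
Implicit Types N : nat.

(** [Q] touches [F] from above at [x], so its difference quotients dominate those of [F]. Along d =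
    xi - grad Q x those of [Q] tend to -|d|, which a nonnegative lower limit allows only for d =
    0. *)
Lemma regular_subgradient_lsq N (F : 'rV[R]_N -> R) (Q : lsq N) x xi :
  (forall y, F y <= lsq_val Q y) -> F x = lsq_val Q x ->
  regular_subgradient (fun y => (F y)%:E) x xi -> xi = lsq_grad Q x.
Proof.
move=> FQ Fx [_]; rewrite limf_einfE => sup_ge0.
apply/eqP; rewrite -subr_eq0; apply: contraT; set d := _ - _ => d0.
have D0 : 0 < inner d d by rewrite inner_gt0.
have e0 : 0 < enorm d by rewrite sqrtr_gt0.
(* Some punctured neighbourhood [V] has all quotients above -|d|/2; a short step along [d] will
   violate this. *)
have : ((- (enorm d / 2))%:E < 0)%E by rewrite lte_fin oppr_lt0 divr_gt0.
move=> /lt_le_trans/(_ sup_ge0)/ereal_sup_gtP[_ [V xV <-] infV].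
set s := inner (d *m lsq_mx Q) (d *m lsq_mx Q).
have s0 : 0 <= s by exact: inner_ge0.
have Vt : \forall t \near (0 : R)^'+, x + t *: d != x -> V (x + t *: d).
  have : x + t *: d @[t --> (0 : R)] --> x + 0 *: d.
    by apply: cvgD; [exact: cvg_cst|apply: cvgZr_tmp; exact: cvg_id].
  by rewrite scale0r addr0 => /cvg_at_right_filter cvgx; exact: (cvgx _ xV).
(* This bound gives t s < |d|^2, so the second-order term t^2 s / 2 is below half of t |d|^2. The
   denominator s + 1 stays positive when s = 0. *)
have [t [[t0 ts] /(_ _)Vxt]] : exists t, (0 < t /\ t < inner d d / (s + 1)) /\
    (x + t *: d != x -> V (x + t *: d)).
  apply: (@filter_ex _ (0 : R)^'+); apply: filterI => //; apply: filterI.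
    exact: nbhs_right_gt.
  by apply: nbhs_right_lt; rewrite divr_gt0// ltr_wpDl.
have {}Vxt : V (x + t *: d).
  by apply: Vxt; rewrite addrC -subr_eq0 addrK scaler_eq0 negb_or gt_eqF.
have := lt_le_trans infV (ereal_inf_lbound (imageP _ Vxt)).
rewrite /= [_ - x]addrAC subrr add0r -!EFinB -EFinM lte_fin.
rewrite enormZ ?ltW// innerZr ltr_pdivlMr ?mulr_gt0//.
have := FQ (x + t *: d); rewrite lsq_valD Fx innerZr.
rewrite -scalemxAl innerZl innerZr -/s.
have -> : inner xi d = inner d d + inner (lsq_grad Q x) d.
  by rewrite -innerDl subrK.
have := enorm_sqr d; rewrite expr2.
have s1 : 0 < s + 1 by rewrite ltr_wpDl.
move: ts; rewrite ltr_pdivlMr//.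
move: (enorm d) (inner d d) e0 D0 => e D e0 D0 ts eD H1 H2.
have : t * (t * s) < t * D by rewrite ltr_pM2l//; nra.
have : e / 2 * (t * e) = t * D / 2 by rewrite -eD; field.
lra.
Qed.

(* Pigeonhole: for each piece, failure of the conclusion is an open condition,
   which would persist along the approximating sequence for all pieces. *)
Lemma limiting_subdiff_min_lsq N (I : finType) (Q : I -> lsq N)
    (F : 'rV[R]_N -> R) x xi :
  is_min_lsq Q F -> limiting_subdiff (fun y => (F y)%:E) x xi ->
  exists i, F x = lsq_val (Q i) x /\ xi = lsq_grad (Q i) x.
Proof.
move=> [FQ exQ] [_ [xs [xis [xsx Fxs xisxi reg]]]].
apply: contrapT => nex.
have /filter_forall : forall i, \forall k \near \oo,
    ~ (F (xs k) = lsq_val (Q i) (xs k) /\ xis k = lsq_grad (Q i) (xs k)).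
  move=> i; have [FQi|FQi] := pselect (F x = lsq_val (Q i) x); last first.
    have : F (xs k) - lsq_val (Q i) (xs k) @[k --> \oo] -->
        F x - lsq_val (Q i) x.
      apply: cvgB; first exact: (fine_cvg Fxs).
      exact: (cvg_comp _ _ xsx (@continuous_lsq_val R N (Q i) x)).
    move=> /cvgr_neq0; rewrite subr_eq0 => /(_ (introN eqP FQi)).
    by apply: filterS => k; rewrite subr_eq0 => /eqP nFQ [].
  have [j nj] : exists j, xi 0 j != lsq_grad (Q i) x 0 j.
    apply: contrapT => nj; apply: nex; exists i; split => //.
    apply/rowP => j; apply: contrapT => /eqP ?; apply: nj; by exists j.
  have : xis k 0 j - lsq_grad (Q i) (xs k) 0 j @[k --> \oo] -->
      xi 0 j - lsq_grad (Q i) x 0 j.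
    apply: cvgB.
      exact: (cvg_comp _ _ xisxi (@coord_continuous R 1 N 0 j xi)).
    exact: (cvg_comp _ _ xsx (@continuous_lsq_grad_coord R N (Q i) j x)).
  move=> /cvgr_neq0; rewrite subr_eq0 => /(_ nj).
  by apply: filterS => k; rewrite subr_eq0 => /eqP nE [_ E]; apply: nE; rewrite E.
move=> /filter_ex[k nk]; have [i Fi] := exQ (xs k).
by apply: (nk i); split => //; exact: regular_subgradient_lsq (FQ i) Fi (reg k).
Qed.

Lemma derive1_desingularizing (c s : R) : 0 < s ->
  derive1 (desingularizing c (1 / 2)) s = c / (2 * Num.sqrt s).
Proof.
move=> s0; rewrite /desingularizing.
have -> : 1 - 1 / 2 = 2^-1 :> R by field.
have D := is_derive1_powR (2^-1 : R) s0.
rewrite derive1Ml ?derive1E ?derive_val; last by case: D.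
have -> : (2^-1 - 1 : R) = - 2^-1 by field.
by rewrite powRN powR12_sqrt ?ltW// invfM.
Qed.

(** A piece inactive at [x] lies strictly above an active one there, hence also nearby by
    continuity, where it cannot attain the minimum. Finiteness of [I] gives one neighbourhood for
    all pieces. *)
Lemma min_lsq_near_active N (I : finType) (Q : I -> lsq N)
    (F : 'rV[R]_N -> R) x : is_min_lsq Q F ->
  \forall y \near x, forall i, F y = lsq_val (Q i) y -> F x = lsq_val (Q i) x.
Proof.
move=> [FQ exQ].
suff /filter_forall : forall i, \forall y \near x,
    F y = lsq_val (Q i) y -> F x = lsq_val (Q i) x by [].
move=> i; have [FQi|FQi] := pselect (F x = lsq_val (Q i) x).
  exact: (@nearW _ (nbhs x)).
have [j Fj] := exQ x.
have : 0 < lsq_val (Q i) x - lsq_val (Q j) x.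
  by rewrite subr_gt0 -Fj lt_neqAle FQ andbT; apply/eqP.
have : lsq_val (Q i) y - lsq_val (Q j) y @[y --> x] -->
    lsq_val (Q i) x - lsq_val (Q j) x.
  apply: (cvgB (@continuous_lsq_val R N (Q i) x)).
  exact: (@continuous_lsq_val R N (Q j) x).
move=> /cvgr_gt /[apply]; apply: filterS => y; rewrite subr_gt0 => ji Fy.
by have := FQ j y; rewrite Fy leNgt ji.
Qed.

Lemma KL_function_min_of_lsq N (F : 'rV[R]_N -> R) :
  min_of_lsq F -> KL_function (fun x => (F x)%:E) (1 / 2).
Proof.
move=> [I [Q FQ]]; split.
- split=> [x|]; first exact: ltNyr.
  by exists 0; exact: ltry.
- move=> x a; rewrite lte_fin => aFx.
  (* [F] exceeds [a] exactly where every piece does: finitely many open conditions. *)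
  exists [set y | forall i, a < lsq_val (Q i) y].
    suff /filter_forall : forall i, \forall y \near x, a < lsq_val (Q i) y by [].
    move=> i; apply: (cvgr_gt _ (@continuous_lsq_val R N (Q i) x)).
    exact: lt_le_trans aFx (FQ.1 i x).
  by move=> y /= aQ; have [i ->] := FQ.2 y; rewrite lte_fin.
- lra.
move=> xbar _.
have [C HC] := choice (fun i => lsq_grad_dominated (Q i)).
pose K := 1 + \sum_i C i.
have K0 : 0 < K by rewrite ltr_pwDl// sumr_ge0// => i _; exact/ltW/(HC i).1.
have CK i : C i <= K.
  rewrite /K (bigD1 i)//= addrCA lerDl addr_ge0// sumr_ge0// => j _.
  exact/ltW/(HC j).1.
(* With this constant psi'(s) = sqrt (K / s), so the KL inequality becomes s <= K |xi|^2 for every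
   limiting subgradient xi. *)
exists (2 * Num.sqrt K), +oo%E; split => //.
  by rewrite mulr_gt0// sqrtr_gt0.
have := min_lsq_near_active xbar FQ; apply: filterS => x active.
rewrite lte_fin => /andP[Fx _]; rewrite -EFinB /=.
set s := F x - F xbar; have s0 : 0 < s by rewrite subr_gt0.
have r0 : 0 < Num.sqrt s by rewrite sqrtr_gt0.
have k0 : 0 < Num.sqrt K by rewrite sqrtr_gt0.
rewrite derive1_desingularizing// -lee_pdivrMl; last first.
  by rewrite divr_gt0// mulr_gt0.
(* The distance is an infimum, so each subgradient is bounded separately; an empty subdifferential
   leaves nothing to check. *)
apply/ereal_infP => _ [xi dxi <-].
have [i [Fi ->]] := limiting_subdiff_min_lsq FQ dxi.
rewrite mule1 lee_fin.
have -> : (2 * Num.sqrt K / (2 * Num.sqrt s))^-1 = Num.sqrt s / Num.sqrt K.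
  by field; rewrite !gt_eqF.
rewrite ler_pdivrMr// /enorm -sqrtrM ?inner_ge0// ler_sqrt; last first.
  by rewrite mulr_ge0 ?inner_ge0// ltW.
(* The piece active at [x] is also active at [xbar], so the gap of [F] is the gap of a single
   piece. *)
rewrite /s Fi (active _ Fi) mulrC.
apply: le_trans ((HC i).2 x xbar) _.
by rewrite ler_wpM2r ?inner_ge0.
Qed.

End Subdifferential.

(** * The truncated quadratic functional as a minimum of least-squares functions *)

Theorem theorem1 (R : realType) (m n m0 n0 k : nat) (ml nl cl : 'I_k -> nat)
    (A : {linear 'M[R]_(m, n) -> 'M[R]_(m0, n0)}) (x0 : 'M[R]_(m0, n0))
    (K : forall l : 'I_k,
       {linear 'M[R]_(m, n) -> {ffun 'I_(ml l) * 'I_(nl l) -> 'rV[R]_(cl l)}})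
    (mu tau : 'I_k -> R)
    (mu_gt0 : forall l, 0 < mu l) (tau_gt0 : forall l, 0 < tau l) :
  KL_function
    (fun v : 'rV[R]_(m * n) => (trunc_quad A x0 K mu tau (vec_mx v))%:E)
    (1 / 2).
Proof.
apply: KL_function_min_of_lsq; apply: min_of_lsq_add.
  have half_ge0 : 0 <= 2^-1 :> R by rewrite invr_ge0.
  under eq_fun do rewrite enorm_sqr mulrC linearB.
  exact: (min_of_lsq_linear (mxvec \o A \o vec_mx) (mxvec x0) half_ge0).
apply: min_of_lsq_sum => l; apply: min_of_lsq_sum => i; apply: min_of_lsq_sum => j.
have ml0 : 0 <= mu l / 2 by rewrite divr_ge0// ltW.
(* Evaluation at (i, j) is linear because operations on finite functions are pointwise. *)
have f_linear : linear (fun v : 'rV[R]_(m * n) => K l (vec_mx v) (i, j)).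
  by move=> a u v; rewrite !linearP !ffunE.
pose f : {linear 'rV[R]_(m * n) -> 'rV[R]_(cl l)} :=
  HB.pack (fun v : 'rV[R]_(m * n) => K l (vec_mx v) (i, j))
    (GRing.isLinear.Build _ _ _ _ _ f_linear).
(* The nonnegative weight moves inside the minimum, leaving a least-squares piece with target 0 and
   a constant piece. *)
under eq_fun do rewrite minr_pMr// enorm_sqr -[K l _ _]subr0.
exact: min_of_lsq_min (min_of_lsq_linear f 0 ml0) (min_of_lsq_cst _ _).
Qed.
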